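(* Let $\mathcal U$ be the set of points $(f,U,\Upsilon,\theta)$ defined in the context. Then: (i) valid upper bounds on $\frac{f_1^{\mathrm{rs}}}{\alpha_1-\theta}$ and on $\frac{f_2^{\mathrm{rs}}}{\theta-\alpha_2}$ over $\mathcal U$ are given, respectively, by $$(H_1^{\mathrm{rs}})^{\mathrm{up}}=\frac{(\Upsilon^{\mathrm{rs}})^{\mathrm{up}}(\alpha_1-\alpha_2)+\alpha_1F_1+\alpha_2F_2}{\alpha_1(\alpha_1-\alpha_2)},\qquad (H_2^{\mathrm{rs}})^{\mathrm{up}}=\frac{\alpha_1F_1+\alpha_2F_2-\bigl(E^{\mathrm{rs}}\cdot(\alpha_1-\theta)\bigr)^{\mathrm{lo}}}{\alpha_2(\alpha_1-\alpha_2)};$$ (ii) the admissible region of $\theta$ in the interval $[\alpha_2,\alpha_1]$ is given by: every point of $\mathcal U$ satisfies $$\alpha_2+\frac{f_2^{\mathrm{rs}}}{(H_2^{\mathrm{rs}})^{\mathrm{up}}}\le\theta\le\alpha_1-\frac{f_1^{\mathrm{rs}}}{(H_1^{\mathrm{rs}})^{\mathrm{up}}}.$$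
   Context: Constants: $0<\alpha_2<\alpha_1$ (relative volatilities); $F_1,F_2>0$ (component flow rates); nonnegative upper bounds $(U^{\mathrm{rs}})^{\mathrm{up}},(U^{\mathrm{ss}})^{\mathrm{up}},(\Upsilon^{\mathrm{rs}})^{\mathrm{up}},(\Upsilon^{\mathrm{ss}})^{\mathrm{up}}$; $\alpha_2\le\theta^{\mathrm{lo}}\le\theta^{\mathrm{up}}\le\alpha_1$. $\mathcal U$ is the set of real $(f,U,\Upsilon,\theta)$, with $f=(f_p^{\mathrm{in}},f_p^{\mathrm{rs}},f_p^{\mathrm{ss}})_{p=1,2}$, $U=(U^{\mathrm{rs}},U^{\mathrm{ss}})$, $\Upsilon=(\Upsilon^{\mathrm{rs}},\Upsilon^{\mathrm{ss}})$, such that all fractions below are defined (so $\alpha_2<\theta<\alpha_1$) and $$\frac{\alpha_1f_1^{\mathrm{in}}}{\alpha_1-\theta}-\frac{\alpha_2f_2^{\mathrm{in}}}{\theta-\alpha_2}=U^{\mathrm{rs}}-U^{\mathrm{ss}},\qquad E^{\mathrm{rs}}\le\frac{\alpha_1f_1^{\mathrm{rs}}}{\alpha_1-\theta}-\frac{\alpha_2f_2^{\mathrm{rs}}}{\theta-\alpha_2}\le\Upsilon^{\mathrm{rs}},\qquad E^{\mathrm{ss}}\le-\frac{\alpha_1f_1^{\mathrm{ss}}}{\alpha_1-\theta}+\frac{\alpha_2f_2^{\mathrm{ss}}}{\theta-\alpha_2}\le\Upsilon^{\mathrm{ss}},$$ $\theta^{\mathrm{lo}}\le\theta\le\theta^{\mathrm{up}}$,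 $U^{\mathrm{rs}}-U^{\mathrm{ss}}=\Upsilon^{\mathrm{rs}}-\Upsilon^{\mathrm{ss}}$, $f_p^{\mathrm{in}}=f_p^{\mathrm{rs}}+f_p^{\mathrm{ss}}$ and $(f_p^{\mathrm{in}},f_p^{\mathrm{rs}},f_p^{\mathrm{ss}})\in[0,F_p]^3$ for $p=1,2$, and $0\le U^{\mathrm{rs}}\le(U^{\mathrm{rs}})^{\mathrm{up}}$, $0\le U^{\mathrm{ss}}\le(U^{\mathrm{ss}})^{\mathrm{up}}$, $0\le\Upsilon^{\mathrm{rs}}\le(\Upsilon^{\mathrm{rs}})^{\mathrm{up}}$, $0\le\Upsilon^{\mathrm{ss}}\le(\Upsilon^{\mathrm{ss}})^{\mathrm{up}}$. Here $E^{\mathrm{rs}}$ and $E^{\mathrm{ss}}$ are given lower-bounding quantities (bounded real-valued functions of the variables: $E^{\mathrm{rs}}$ is either $\Upsilon^{\mathrm{rs}}$ itself, when the corresponding inequality must be binding, or a lower bound such as $0$ or $U^{\mathrm{rs}}-U^{\mathrm{ss}}$; similarly for $E^{\mathrm{ss}}$). $\bigl(E^{\mathrm{rs}}\cdot(\alpha_1-\theta)\bigr)^{\mathrm{lo}}$ denotes a real constant that is a lower bound for $E^{\mathrm{rs}}\cdot(\alpha_1-\theta)$ over $\mathcal U$ (obtained from the bounds on $E^{\mathrm{rs}}$ and $\theta$). *)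

(* Defs.v *)
From Stdlib Require Import Reals.
Local Open Scope R_scope.

Inductive component : Set := comp1 | comp2.

(* Suffixes [_rs] / [_ss] stand for rectifying / stripping section; [Y] stands
   for Upsilon. *)
Record parameters : Type := MkParameters {
  alpha : component -> R;  (* relative volatilities *)
  F : component -> R;      (* component flow rates *)
  U_rs_up : R;
  U_ss_up : R;
  Y_rs_up : R;
  Y_ss_up : R;
  theta_lo : R;
  theta_up : R
}.

Record admissible_parameters (P : parameters) : Prop := {
  alpha_pos : 0 < alpha P comp2;
  alpha_lt : alpha P comp2 < alpha P comp1;
  F_pos : forall p, 0 < F P p;
  U_rs_up_ge0 : 0 <= U_rs_up P;
  U_ss_up_ge0 : 0 <= U_ss_up P;
  Y_rs_up_ge0 : 0 <= Y_rs_up P;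
  Y_ss_up_ge0 : 0 <= Y_ss_up P;
  theta_lo_ge : alpha P comp2 <= theta_lo P;
  theta_lo_le_up : theta_lo P <= theta_up P;
  theta_up_le : theta_up P <= alpha P comp1
}.

Record point : Type := MkPoint {
  f_in : component -> R;
  f_rs : component -> R;
  f_ss : component -> R;
  U_rs : R;
  U_ss : R;
  Y_rs : R;
  Y_ss : R;
  theta : R
}.

(* Division on [R] is total, so the requirement
   that the fractions be defined is the explicit constraint [theta_interior]. *)
Record calU (P : parameters) (E_rs E_ss : point -> R) (x : point) : Prop := {
  theta_interior : alpha P comp2 < theta x < alpha P comp1;
  underwood_in :
    alpha P comp1 * f_in x comp1 / (alpha P comp1 - theta x)
      - alpha P comp2 * f_in x comp2 / (theta x - alpha P comp2)
    = U_rs x - U_ss x;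
  underwood_rs :
    E_rs x
    <= alpha P comp1 * f_rs x comp1 / (alpha P comp1 - theta x)
         - alpha P comp2 * f_rs x comp2 / (theta x - alpha P comp2)
    <= Y_rs x;
  underwood_ss :
    E_ss x
    <= - (alpha P comp1 * f_ss x comp1 / (alpha P comp1 - theta x))
         + alpha P comp2 * f_ss x comp2 / (theta x - alpha P comp2)
    <= Y_ss x;
  theta_bounds : theta_lo P <= theta x <= theta_up P;
  vapor_balance : U_rs x - U_ss x = Y_rs x - Y_ss x;
  flow_balance : forall p, f_in x p = f_rs x p + f_ss x p;
  f_in_bounds : forall p, 0 <= f_in x p <= F P p;
  f_rs_bounds : forall p, 0 <= f_rs x p <= F P p;
  f_ss_bounds : forall p, 0 <= f_ss x p <= F P p;
  U_rs_bounds : 0 <= U_rs x <= U_rs_up P;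
  U_ss_bounds : 0 <= U_ss x <= U_ss_up P;
  Y_rs_bounds : 0 <= Y_rs x <= Y_rs_up P;
  Y_ss_bounds : 0 <= Y_ss x <= Y_ss_up P
}.

Definition bounded_over (S : point -> Prop) (g : point -> R) : Prop :=
  exists M, forall x, S x -> Rabs (g x) <= M.

Definition lower_bound_over (S : point -> Prop) (g : point -> R) (m : R) : Prop :=
  forall x, S x -> m <= g x.

Definition upper_bound_over (S : point -> Prop) (g : point -> R) (M : R) : Prop :=
  forall x, S x -> g x <= M.

Definition H1_rs_up (P : parameters) : R :=
  (Y_rs_up P * (alpha P comp1 - alpha P comp2)
     + alpha P comp1 * F P comp1 + alpha P comp2 * F P comp2)
  / (alpha P comp1 * (alpha P comp1 - alpha P comp2)).

(* [Elo] is a constant lower bound for [E_rs * (alpha_1 - theta)] over [calU].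
   When [calU] is nonempty, [Elo <= alpha_1 * F_1] (from [underwood_rs]), so
   this quantity is positive and may be divided by. *)
Definition H2_rs_up (P : parameters) (Elo : R) : R :=
  (alpha P comp1 * F P comp1 + alpha P comp2 * F P comp2 - Elo)
  / (alpha P comp2 * (alpha P comp1 - alpha P comp2)).

(* Main.v *)
(* Multiplying the rectifying-section inequality by [theta - alpha_2] (resp.
   [alpha_1 - theta]) clears one denominator; as these two factors sum to
   [alpha_1 - alpha_2], the other ratio [h] then occurs only through
   [h * (alpha_1 - alpha_2)] and the numerator of [h], which gives the bounds
   in (i).  Part (ii) is (i) solved for [theta]. *)
Require Import Defs.
From Stdlib Require Import Reals Lra.
Local Open Scope R_scope.

Lemma Rdiv_le_iff (a b c : R) : 0 < b -> a / b <= c <-> a <= c * b.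
Proof.
  intros hb; split; intros h.
  - apply (Rmult_le_compat_r b) in h; [|lra].
    now replace (a / b * b) with a in h by (field; lra).
  - apply (Rmult_le_reg_r b); [exact hb|].
    now replace (a / b * b) with a by (field; lra).
Qed.

(** Both inequalities amount to [a <= b * c]. This carries the bounds of part (i) over to part (ii),
    with [b] the distance from [theta] to a volatility and [c] the bound on the ratio. *)
Lemma Rdiv_le_swap (a b c : R) : 0 < b -> 0 < c -> a / b <= c -> a / c <= b.
Proof.
  intros hb hc h.
  apply Rdiv_le_iff; [exact hc|].
  rewrite Rmult_comm; now apply Rdiv_le_iff.
Qed.

Lemma H1_rs_up_pos (P : parameters) (hP : admissible_parameters P) :
  0 < H1_rs_up P.
Proof.
  destruct hP as [ha2 ha12 hF _ _ hY _ _ _ _].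
  pose proof (hF comp1); pose proof (hF comp2).
  unfold H1_rs_up; apply Rdiv_lt_0_compat; nra.
Qed.

Lemma H1_rs_up_valid (P : parameters) (E_rs E_ss : point -> R)
  (hP : admissible_parameters P) :
  upper_bound_over (calU P E_rs E_ss)
    (fun x => f_rs x comp1 / (alpha P comp1 - theta x)) (H1_rs_up P).
Proof.
  intros x [[ht2 ht1] _ [_ hY] _ _ _ _ _ hf _ _ _ [_ hYup] _].
  destruct hP as [ha2 ha12 _ _ _ hY0 _ _ _ _].
  destruct (hf comp1) as [_ hf1]; destruct (hf comp2) as [_ hf2].
  set (h := f_rs x comp1 / (alpha P comp1 - theta x)).
  assert (eh : h * (alpha P comp1 - theta x) = f_rs x comp1)
    by (unfold h; field; lra).
  apply (Rmult_le_compat_r (theta x - alpha P comp2)) in hY; [|lra].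
  replace (_ * (theta x - alpha P comp2)) with
    (alpha P comp1 * h * (theta x - alpha P comp2)
       - alpha P comp2 * f_rs x comp2) in hY by (unfold h; field; lra).
  (* Both factors are enlarged in turn: [Y_rs x] to [Y_rs_up P], then [theta x] to [alpha P comp1],
     the latter using [0 <= Y_rs_up P]. *)
  assert (Y_rs x * (theta x - alpha P comp2)
          <= Y_rs_up P * (alpha P comp1 - alpha P comp2)) by nra.
  assert (alpha P comp1 * f_rs x comp1 <= alpha P comp1 * F P comp1) by nra.
  assert (alpha P comp2 * f_rs x comp2 <= alpha P comp2 * F P comp2) by nra.
  assert (hpos : 0 < alpha P comp1 * (alpha P comp1 - alpha P comp2)) by nra.
  unfold H1_rs_up; apply (Rmult_le_reg_r _ _ _ hpos).
  unfold Rdiv; rewrite Rmult_assoc, Rinv_l, Rmult_1_r by lra.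
  (* Splits [alpha_1 - alpha_2] at [theta]: [hY] controls the first summand, and the second
     collapses to [alpha_1 * f_rs x comp1] by [eh]. *)
  replace (h * _) with
    (alpha P comp1 * h * (theta x - alpha P comp2)
       + alpha P comp1 * (h * (alpha P comp1 - theta x))) by ring.
  rewrite eh; lra.
Qed.

(** The lower half of [underwood_rs] is multiplied by [alpha_1 - theta], then [f_rs x comp1] is
    enlarged to [F P comp1]. The ratio for [comp2] is kept: discarding it by sign gives positivity
    of [H2_rs_up], bounding it gives validity. *)
Lemma Elo_le (P : parameters) (E_rs E_ss : point -> R) (Elo : R)
  (hP : admissible_parameters P)
  (hElo : lower_bound_over (calU P E_rs E_ss)
            (fun x => E_rs x * (alpha P comp1 - theta x)) Elo)
  (x : point) (hx : calU P E_rs E_ss x) :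
  Elo <= alpha P comp1 * F P comp1
         - alpha P comp2 * (f_rs x comp2 / (theta x - alpha P comp2))
           * (alpha P comp1 - theta x).
Proof.
  pose proof (hElo x hx) as hE; cbv beta in hE.
  destruct hx as [[ht2 ht1] _ [hErs _] _ _ _ _ _ hf _ _ _ _ _].
  destruct hP as [ha2 ha12 _ _ _ _ _ _ _ _].
  destruct (hf comp1) as [_ hf1].
  apply (Rmult_le_compat_r (alpha P comp1 - theta x)) in hErs; [|lra].
  assert (alpha P comp1 * f_rs x comp1 <= alpha P comp1 * F P comp1) by nra.
  apply (Rle_trans _ _ _ hE), (Rle_trans _ _ _ hErs).
  apply (Rle_trans _ (alpha P comp1 * f_rs x comp1
         - alpha P comp2 * (f_rs x comp2 / (theta x - alpha P comp2))
           * (alpha P comp1 - theta x))); [|lra].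
  right; field; lra.
Qed.

(** A point [x] is required because over an empty [calU] any [Elo], however large, is a lower bound.
    Given [x], [Elo <= alpha_1 * F_1], so the numerator is at least [alpha_2 * F_2]. *)
Lemma H2_rs_up_pos (P : parameters) (E_rs E_ss : point -> R) (Elo : R)
  (hP : admissible_parameters P)
  (hElo : lower_bound_over (calU P E_rs E_ss)
            (fun x => E_rs x * (alpha P comp1 - theta x)) Elo)
  (x : point) (hx : calU P E_rs E_ss x) :
  0 < H2_rs_up P Elo.
Proof.
  pose proof (Elo_le P E_rs E_ss Elo hP hElo x hx) as hE.
  destruct hx as [[ht2 ht1] _ _ _ _ _ _ _ hf _ _ _ _ _].
  destruct hP as [ha2 ha12 hF _ _ _ _ _ _ _].
  pose proof (hF comp2); destruct (hf comp2) as [hf2 _].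
  set (h := f_rs x comp2 / (theta x - alpha P comp2)) in *.
  assert (0 <= h) by (apply Rle_mult_inv_pos; lra).
  assert (0 <= alpha P comp2 * h * (alpha P comp1 - theta x))
    by (apply Rmult_le_pos; [apply Rmult_le_pos|]; lra).
  assert (0 < alpha P comp2 * F P comp2) by nra.
  unfold H2_rs_up; apply Rdiv_lt_0_compat; [lra|nra].
Qed.

Lemma H2_rs_up_valid (P : parameters) (E_rs E_ss : point -> R) (Elo : R)
  (hP : admissible_parameters P)
  (hElo : lower_bound_over (calU P E_rs E_ss)
            (fun x => E_rs x * (alpha P comp1 - theta x)) Elo) :
  upper_bound_over (calU P E_rs E_ss)
    (fun x => f_rs x comp2 / (theta x - alpha P comp2)) (H2_rs_up P Elo).
Proof.
  intros x hx.
  pose proof (Elo_le P E_rs E_ss Elo hP hElo x hx) as hE.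
  destruct hx as [[ht2 ht1] _ _ _ _ _ _ _ hf _ _ _ _ _].
  destruct hP as [ha2 ha12 _ _ _ _ _ _ _ _].
  destruct (hf comp2) as [_ hf2].
  set (h := f_rs x comp2 / (theta x - alpha P comp2)) in *.
  assert (eh : h * (theta x - alpha P comp2) = f_rs x comp2)
    by (unfold h; field; lra).
  assert (alpha P comp2 * f_rs x comp2 <= alpha P comp2 * F P comp2) by nra.
  assert (hpos : 0 < alpha P comp2 * (alpha P comp1 - alpha P comp2)) by nra.
  unfold H2_rs_up; apply (Rmult_le_reg_r _ _ _ hpos).
  unfold Rdiv; rewrite Rmult_assoc, Rinv_l, Rmult_1_r by lra.
  (* The same splitting at [theta], with roles exchanged: [hE] bounds the first summand by
     [alpha_1 * F_1 - Elo], and [eh] turns the second into [alpha_2 * f_rs x comp2]. *)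
  replace (h * _) with
    (alpha P comp2 * h * (alpha P comp1 - theta x)
       + alpha P comp2 * (h * (theta x - alpha P comp2))) by ring.
  rewrite eh; lra.
Qed.

Theorem proposition11
  (P : parameters) (E_rs E_ss : point -> R) (Elo : R)
  (hP : admissible_parameters P)
  (hE_rs : bounded_over (calU P E_rs E_ss) E_rs)
  (hE_ss : bounded_over (calU P E_rs E_ss) E_ss)
  (hElo : lower_bound_over (calU P E_rs E_ss)
            (fun x => E_rs x * (alpha P comp1 - theta x)) Elo) :
  (upper_bound_over (calU P E_rs E_ss)
     (fun x => f_rs x comp1 / (alpha P comp1 - theta x)) (H1_rs_up P)
   /\ upper_bound_over (calU P E_rs E_ss)
     (fun x => f_rs x comp2 / (theta x - alpha P comp2)) (H2_rs_up P Elo))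
  /\ (forall x, calU P E_rs E_ss x ->
        alpha P comp2 + f_rs x comp2 / H2_rs_up P Elo
        <= theta x
        <= alpha P comp1 - f_rs x comp1 / H1_rs_up P).
Proof.
  pose proof (H1_rs_up_valid P E_rs E_ss hP) as h1.
  pose proof (H2_rs_up_valid P E_rs E_ss Elo hP hElo) as h2.
  split; [now split|].
  intros x hx; destruct (theta_interior _ _ _ _ hx) as [ht2 ht1].
  assert (f_rs x comp2 / H2_rs_up P Elo <= theta x - alpha P comp2).
  { apply Rdiv_le_swap; [lra| |exact (h2 x hx)].
    exact (H2_rs_up_pos P E_rs E_ss Elo hP hElo x hx). }
  assert (f_rs x comp1 / H1_rs_up P <= alpha P comp1 - theta x).
  { apply Rdiv_le_swap; [lra| |exact (h1 x hx)].
    exact (H1_rs_up_pos P hP). }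
  lra.
Qed.
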